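(* Let $R$ be a countable ring, let $A$ be a Polish $R$-module and let $\varphi/\psi$ be a pp-pair in a finite tuple $\mathbf u$ of free variables. Then the index $[\varphi(A):\psi(A)]$ is either countable or equal to $\mathfrak c=2^{\aleph_0}$. In other words, $$\mathrm{Th}_{\mathrm{Pun}}(A)\vdash[\varphi:\psi]>1\quad\text{if and only if}\quad[\varphi(A):\psi(A)]=\mathfrak c.$$
   Context: Rings have an identity $1\neq 0$; modules are unital left modules; $R$ is given the discrete topology. A Polish $R$-module is an $R$-module $A$ with a separable completely metrizable topology for which $(A,+,-,0)$ is a topological group and scalar multiplication $R\times A\to A$ is continuous. A pp-formula $\varphi(\mathbf u)$ is (up to equivalence over the axioms of $R$-modules) an existentially quantified finite system of homogeneous $R$-linear equations; $\varphi(A)\subseteq A^{|\mathbf u|}$ is its solution set, a subgroup. A pp-pair $\varphi/\psi$ consists of pp-formulae in the same variables with $\psi\to\varphi$ valid in every $R$-module. $\mathrm{Th}_{\mathrm{Pun}}(A)$ is the complete (consistent) theory of $R$-modules prescribing, for every pp-pair $\varphi/\psi$, that $[\varphi:\psi]$ is infinite if $[\varphi(A):\psi(A)]>\aleph_0$ and that $[\varphi:\psi]=1$ if $[\varphi(A):\psi(A)]\le\aleph_0$. *)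

(* Defs.v *)
From HB Require Import structures.
From mathcomp Require Import all_boot all_order all_algebra.
From mathcomp Require Import all_classical all_reals all_analysis.

Set Implicit Arguments.
Unset Strict Implicit.
Unset Printing Implicit Defensive.

Import Order.TTheory GRing.Theory Num.Theory.

Local Open Scope classical_set_scope.
Local Open Scope card_scope.
Local Open Scope ring_scope.

Definition separable_space (T : topologicalType) : Prop :=
  exists2 D : set T, countable D & dense D.

Definition completely_metrizable (K : realType) (T : topologicalType) : Prop :=
  exists d : T -> T -> K,
    [/\ (forall x y, d x y = 0 <-> x = y),
        (forall x y, d x y = d y x),
        (forall x y z, d x z <= d x y + d y z),
        (forall U : set T, open U <->
           forall x, U x -> exists2 e : K, 0 < e & [set y | d x y < e] `<=` U) &
        (forall u : nat -> T,
           (forall e : K, 0 < e -> exists N, forall i j,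
              (N <= i)%N -> (N <= j)%N -> d (u i) (u j) < e) ->
           exists l : T, u @ \oo --> l)].

(* A topological abelian group with a left scalar multiplication: the library's
   joint topological/module structures only allow an ordered scalar domain.
   [K] is just the copy of the real numbers in which metrics take values. *)
Record polishModType (K : realType) (R : nzRingType) := PolishModType {
  polish_group :> topologicalZmodType;
  polish_scale : R -> polish_group -> polish_group;
  polish_scaleA : forall r s a,
    polish_scale r (polish_scale s a) = polish_scale (r * s) a;
  polish_scale1 : left_id 1 polish_scale;
  polish_scaleDr : right_distributive polish_scale +%R;
  polish_scaleDl : forall a, {morph polish_scale^~ a : r s / r + s};
  polish_scale_continuous :
    continuous (fun z : discrete_topology R * polish_group =>
                  polish_scale z.1 z.2);
  polish_separable : separable_space polish_group;
  polish_completely_metrizable : completely_metrizable K polish_group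
}.

Definition polish_carrier (K : realType) (R : nzRingType)
  (A : polishModType K R) : Type := A.

HB.instance Definition _ K R (A : polishModType K R) :=
  GRing.Zmodule.copy (polish_carrier A) A.
HB.instance Definition _ K R (A : polishModType K R) :=
  GRing.Zmodule_isLmodule.Build R (polish_carrier A)
    (@polish_scaleA _ _ A) (@polish_scale1 _ _ A)
    (@polish_scaleDr _ _ A) (@polish_scaleDl _ _ A).

Definition polish_lmod (K : realType) (R : nzRingType)
  (A : polishModType K R) : lmodType R := polish_carrier A.

(* exists w, pp_free * u + pp_bound * w = 0, with u an n-tuple. *)
Record ppform (R : nzRingType) (n : nat) := PPForm {
  pp_eqs : nat;
  pp_ex : nat;
  pp_free : 'M[R]_(pp_eqs, n);
  pp_bound : 'M[R]_(pp_eqs, pp_ex)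
}.

Definition pp_sol (R : nzRingType) (n : nat) (phi : ppform R n)
    (M : lmodType R) : set 'rV[M]_n :=
  [set u | exists w : 'rV[M]_(pp_ex phi), forall i,
     \sum_j pp_free phi i j *: u 0 j + \sum_j pp_bound phi i j *: w 0 j = 0].
Arguments pp_sol {R n} phi M _.

Definition pp_pair (R : nzRingType) (n : nat) (phi psi : ppform R n) : Prop :=
  forall M : lmodType R, pp_sol psi M `<=` pp_sol phi M.

(* The quotient phi(M)/psi(M), as the set of cosets of psi(M) in phi(M); the
   index is its cardinality. *)
Definition pp_cosets (R : nzRingType) (n : nat) (phi psi : ppform R n)
    (M : lmodType R) : set (set 'rV[M]_n) :=
  [set C | exists2 u, pp_sol phi M u & C = [set v | pp_sol psi M (v - u)]].
Arguments pp_cosets {R n} phi psi M _.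

(* Variables are de Bruijn indices. *)
Inductive mterm (R : nzRingType) : Type :=
| Var of nat
| Zero
| Add of mterm R & mterm R
| Opp of mterm R
| Scale of R & mterm R.
Arguments Var {R}.
Arguments Zero {R}.

Inductive mform (R : nzRingType) : Type :=
| Bot
| Eq of mterm R & mterm R
| Imp of mform R & mform R
| All of mform R.
Arguments Bot {R}.

Definition Neg R (p : mform R) := Imp p Bot.
Definition Top {R} : mform R := Neg Bot.
Definition And R (p q : mform R) := Neg (Imp p (Neg q)).
Definition Ex R (p : mform R) := Neg (All (Neg p)).

Fixpoint tsubst R (s : nat -> mterm R) (t : mterm R) : mterm R :=
  match t with
  | Var i => s i
  | Zero => Zero
  | Add t1 t2 => Add (tsubst s t1) (tsubst s t2)
  | Opp t1 => Opp (tsubst s t1)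
  | Scale r t1 => Scale r (tsubst s t1)
  end.

Definition tshift R (m : nat) : mterm R -> mterm R :=
  tsubst (fun i => Var (m + i)).

Definition slift R (s : nat -> mterm R) (i : nat) : mterm R :=
  if i is j.+1 then tshift 1 (s j) else Var 0.

Fixpoint fsubst R (s : nat -> mterm R) (p : mform R) : mform R :=
  match p with
  | Bot => Bot
  | Eq t1 t2 => Eq (tsubst s t1) (tsubst s t2)
  | Imp p1 p2 => Imp (fsubst s p1) (fsubst s p2)
  | All p1 => All (fsubst (slift s) p1)
  end.

Definition fshift R : mform R -> mform R := fsubst (fun i => Var i.+1).

Definition finst R (t : mterm R) : mform R -> mform R :=
  fsubst (fun i => if i is j.+1 then Var j else t).

(* Hilbert calculus for classical first-order logic with equality.  As
   generalization is unrestricted, [T] has to consist of sentences. *)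
Inductive provable R (T : set (mform R)) : mform R -> Prop :=
| P_ax p : T p -> provable T p
| P_mp p q : provable T (Imp p q) -> provable T p -> provable T q
| P_gen p : provable T p -> provable T (All p)
| P_K p q : provable T (Imp p (Imp q p))
| P_S p q r :
    provable T (Imp (Imp p (Imp q r)) (Imp (Imp p q) (Imp p r)))
| P_dneg p : provable T (Imp (Neg (Neg p)) p)
| P_inst p t : provable T (Imp (All p) (finst t p))
| P_dist p q : provable T (Imp (All (Imp p q)) (Imp (All p) (All q)))
| P_vac p : provable T (Imp p (All (fshift p)))
| P_refl t : provable T (Eq t t)
| P_subst p t1 t2 :
    provable T (Imp (Eq t1 t2) (Imp (finst t1 p) (finst t2 p))).

Inductive module_axiom (R : nzRingType) : mform R -> Prop :=
| M_addA : module_axiom (All (All (All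
    (Eq (Add (Var 0) (Add (Var 1) (Var 2)))
        (Add (Add (Var 0) (Var 1)) (Var 2))))))
| M_addC : module_axiom (All (All
    (Eq (Add (Var 0) (Var 1)) (Add (Var 1) (Var 0)))))
| M_add0 : module_axiom (All (Eq (Add Zero (Var 0)) (Var 0)))
| M_addN : module_axiom (All (Eq (Add (Opp (Var 0)) (Var 0)) Zero))
| M_scaleA r s : module_axiom (All
    (Eq (Scale r (Scale s (Var 0))) (Scale (r * s) (Var 0))))
| M_scale1 : module_axiom (All (Eq (Scale 1 (Var 0)) (Var 0)))
| M_scaleDr r : module_axiom (All (All
    (Eq (Scale r (Add (Var 0) (Var 1)))
        (Add (Scale r (Var 0)) (Scale r (Var 1))))))
| M_scaleDl r s : module_axiom (All
    (Eq (Scale (r + s) (Var 0)) (Add (Scale r (Var 0)) (Scale s (Var 0))))).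

(* The formula phi(t_0, ..., t_{n-1}); its existential quantifiers bind the
   variables 0, ..., pp_ex phi - 1, past which the t_j are shifted. *)
Definition pp_form R n (phi : ppform R n) (t : 'I_n -> mterm R) : mform R :=
  iter (pp_ex phi) (@Ex R)
    (\big[@And R/Top]_(i < pp_eqs phi)
       Eq (Add (\big[@Add R/Zero]_(j < n)
                  Scale (pp_free phi i j) (tshift (pp_ex phi) (t j)))
               (\big[@Add R/Zero]_(j < pp_ex phi)
                  Scale (pp_bound phi i j) (Var j)))
          Zero).

(* [phi : psi] >= k: there are n-tuples u_0, ..., u_{k-1} in phi, lying in
   pairwise distinct cosets of psi; u_i occupies the variables
   i * n, ..., i * n + n - 1. *)
Definition index_ge R n (phi psi : ppform R n) (k : nat) : mform R :=
  let u (i : nat) (l : 'I_n) : mterm R := Var (i * n + l) in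
  iter (k * n) (@Ex R)
    (And (\big[@And R/Top]_(i < k) pp_form phi (u i))
         (\big[@And R/Top]_(i < k) \big[@And R/Top]_(j < k | (i < j)%N)
            Neg (pp_form psi (fun l => Add (u i l) (Opp (u j l)))))).

Definition index_gt1 R n (phi psi : ppform R n) : mform R :=
  index_ge phi psi 2.

(* Axioms for the theory: those of R-modules, and "[phi : psi] is infinite" or
   "[phi : psi] = 1" for each pp-pair.  By the Baur-Monk theorem, prescribing
   each index as infinite or as 1 leaves no sentence undecided. *)
Inductive Th_Pun (R : nzRingType) (A : lmodType R) : set (mform R) :=
| Pun_module p : module_axiom p -> Th_Pun A p
| Pun_infinite n (phi psi : ppform R n) k :
    pp_pair phi psi -> ~ countable (pp_cosets phi psi A) ->
    Th_Pun A (index_ge phi psi k)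
| Pun_one n (phi psi : ppform R n) :
    pp_pair phi psi -> countable (pp_cosets phi psi A) ->
    Th_Pun A (Neg (index_gt1 phi psi)).

(* Main.v *)
Require Import Defs.
From HB Require Import structures.
From mathcomp Require Import all_boot all_order all_algebra.
From mathcomp Require Import all_classical all_reals all_analysis.

Set Implicit Arguments.
Unset Strict Implicit.
Unset Printing Implicit Defensive.

Import Order.TTheory GRing.Theory Num.Theory.

(** The index of psi(A) in phi(A) is the index of the image of a continuous
    homomorphism between Polish groups, and for such images the index is
    countable or 2^aleph_0.

    Let P be the group of pairs (u, w) where w witnesses phi(u), and Q the group
    of triples (u, w, w') where moreover w' witnesses psi(u).  Both are closed
    subgroups of finite powers of A, hence Polish, and the cosets of the image
    of the projection f : Q -> P correspond to the cosets of psi(A) in phi(A)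
    ([pp_index_dichotomy]).  There are two cases ([image_index_dichotomy]).
    - Every neighbourhood of 0 in Q has an image whose closure is a
      neighbourhood of 0 in P.  Then f(Q) is open ([open_mapping]), and an open
      subgroup of a separable group has countable index.
    - Otherwise some neighbourhood V of 0 has an image whose closure is not a
      neighbourhood of 0.  By separability, Q is a countable union of pieces
      with differences in V, and so f(Q) is covered by countably many closed
      nowhere dense sets N_i.  Baire's theorem gives elements g_0, g_1, ... such
      that distinct subseries of the series of the g_n have a difference outside
      all N_i ([perfect_difference_set]), so there are 2^aleph_0 cosets, and a
      Polish group has no more elements than that.

    If the index is 2^aleph_0, then [phi : psi] > 1 is an axiom of Th_Pun(A).
    If it is countable, then the negation of [phi : psi] > 1 is an axiom, so
    what has to be shown is that Th_Pun(A) is consistent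
    ([Th_Pun_consistent]).  This holds for every module M.  A model is M^X
    modulo the functions with countable range, where X = nat * M^nat.  The
    functions with countable range form a pure submodule, hence the pp-formula
    phi holds in the model for (the class of) u : X -> M^n if and only if u
    meets only countably many cosets of phi(M) ([sat_pp_form]).  Therefore
    phi/psi in the model is the group of functions from X to phi(M)/psi(M)
    modulo those with countable range: it is trivial when phi(M)/psi(M) is
    countable ([valid_index_one]) and infinite otherwise ([valid_index_ge]). *)

(** * Relations that hold on countably many pieces *)

Section CountableSplit.
Variable X : Type.
Implicit Types r s : X -> X -> Prop.

(** X is a union of countably many pieces on each of which r holds between any
    two points. With r a uniform entourage this is separability, with r an
    equivalence relation it says that there are countably many classes, and
    with r the relation f x = f y it says that f has countable range. *)
Definition countable_split r : Prop :=
  exists h : X -> nat, forall x y, h x = h y -> r x y.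

Lemma countable_split_by (T : countType) (h : X -> T) r :
  (forall x y, h x = h y -> r x y) -> countable_split r.
Proof.
move=> hr; exists (pickle \o h) => x y /= /(pcan_inj (@pickleK _)); exact: hr.
Qed.

Lemma countable_split_sub r s :
  (forall x y, r x y -> s x y) -> countable_split r -> countable_split s.
Proof. by move=> rs [h hr]; exists h => x y /hr/rs. Qed.

Lemma countable_split_and r s : countable_split r -> countable_split s ->
  countable_split (fun x y => r x y /\ s x y).
Proof.
move=> [h hr] [g gs].
by apply: (countable_split_by (h := fun x => (h x, g x))) => x y [/hr + /gs].
Qed.

Lemma countable_split_forall (I : finType) (r : I -> X -> X -> Prop) :
  (forall i, countable_split (r i)) ->
  countable_split (fun x y => forall i, r i x y).
Proof.
move=> /choice[h hr].
apply: (countable_split_by (h := fun x => [ffun i => h i x])) =>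
  x y /ffunP hxy i.
by apply: hr; have := hxy i; rewrite !ffunE.
Qed.

(** A choice of one representative in each piece; x |-> rep x serves to
    replace a function on X by one with countable range. *)
Lemma countable_split_rep r : countable_split r ->
  exists rep : X -> X,
    countable_split (fun x y => rep x = rep y) /\ forall x, r x (rep x).
Proof.
move=> [h hr].
have /choice[g gP] : forall n, exists g : X -> X, forall x, h x = n ->
    h (g x) = n /\ forall y, h y = n -> g x = g y.
  move=> n; have [[z hz]|nz] := pselect (exists z, h z = n).
    by exists (fun=> z).
  by exists id => x hx; case: nz; exists x.
exists (fun x => g (h x) x); split.
  by exists h => x y hxy; have [_ /(_ y)->] := gP _ x (erefl _); rewrite hxy.
by move=> x; apply: hr; have [-> _] := gP _ x (erefl _).
Qed.

End CountableSplit.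

(** * Solution sets of pp-formulae *)

Section PPFormulas.
Local Open Scope ring_scope.
Variables (R : nzRingType) (M : lmodType R) (n : nat).
Implicit Types phi psi : ppform R n.

(** Bundling the two groups of variables makes the solution set of the
    equations the kernel of an additive map. *)
Definition pp_lin phi (p : 'rV[M]_n * 'rV[M]_(pp_ex phi)) :
    'rV[M]_(pp_eqs phi) :=
  \row_i (\sum_j pp_free phi i j *: p.1 0 j +
          \sum_j pp_bound phi i j *: p.2 0 j).

Arguments pp_lin phi p : clear implicits.

Fact pp_lin_is_zmod_morphism phi : zmod_morphism (pp_lin phi).
Proof.
move=> p q; apply/rowP => i; rewrite !mxE opprD addrACA -!sumrB.
by congr (_ + _); apply: eq_bigr => j _; rewrite !mxE scalerBr.
Qed.

HB.instance Definition _ phi :=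
  GRing.isZmodMorphism.Build _ _ (pp_lin phi) (@pp_lin_is_zmod_morphism phi).

Lemma pp_linB phi u v w w' :
  pp_lin phi (u - v, w - w') = pp_lin phi (u, w) - pp_lin phi (v, w').
Proof. exact: pp_lin_is_zmod_morphism phi (u, w) (v, w'). Qed.

Lemma pp_solP phi u : pp_sol phi M u <-> exists w, pp_lin phi (u, w) = 0.
Proof.
split=> -[w uw]; exists w.
  by apply/rowP => i; rewrite !mxE uw.
by move=> i; have /rowP/(_ i) := uw; rewrite !mxE.
Qed.

Lemma pp_sol0 phi : pp_sol phi M 0.
Proof. by apply/pp_solP; exists 0; apply: (raddf0 (pp_lin phi)). Qed.

Lemma pp_solB phi u v :
  pp_sol phi M u -> pp_sol phi M v -> pp_sol phi M (u - v).
Proof.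
move=> /pp_solP[w uw] /pp_solP[w' vw']; apply/pp_solP; exists (w - w').
by rewrite pp_linB uw vw' subrr.
Qed.

Lemma pp_solN phi u : pp_sol phi M u -> pp_sol phi M (- u).
Proof. by move=> uP; rewrite -sub0r; apply: pp_solB => //; exact: pp_sol0. Qed.

Lemma pp_solD phi u v :
  pp_sol phi M u -> pp_sol phi M v -> pp_sol phi M (u + v).
Proof. by move=> uP vP; rewrite -[v]opprK; apply/pp_solB/pp_solN. Qed.

Definition pp_coset psi u : set 'rV[M]_n :=
  [set v | pp_sol psi M (v - u)]%classic.

Lemma pp_coset_eq psi u v :
  pp_coset psi u = pp_coset psi v <-> pp_sol psi M (u - v).
Proof.
split=> uv.
  rewrite -[_ (u - v)]/(pp_coset psi v u) -uv /pp_coset /= subrr.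
  exact: pp_sol0.
apply/seteqP; split=> w /= wP.
  by rewrite /pp_coset /= -(subrK u w) -addrA; apply: pp_solD.
rewrite /pp_coset /= -(subrK v w) -addrA; apply: pp_solD => //.
by rewrite -opprB; apply: pp_solN.
Qed.

(** In this form countability of the index can be compared with
    [countable_split] without manipulating sets of cosets. *)
Lemma countable_cosetsP phi psi :
  countable (pp_cosets phi psi M) <->
  exists h : 'rV[M]_n -> nat, forall u v, pp_sol phi M u -> pp_sol phi M v ->
    h u = h v -> pp_sol psi M (u - v).
Proof.
split=> [/countable_injP[f finj]|[h hP]].
  exists (f \o pp_coset psi) => u v uP vP /= /finj/= uv.
  by apply/pp_coset_eq/uv; rewrite inE; [exists u|exists v].
have /choice[g gP] : forall C, exists u,
    pp_cosets phi psi M C -> pp_sol phi M u /\ C = pp_coset psi u.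
  move=> C; have [[u uP ->]|nC] := pselect (pp_cosets phi psi M C);
    first by exists u.
  by exists 0.
apply/countable_injP; exists (h \o g) => C D;
  rewrite !inE => /gP[gC {2}->] /gP[gD {2}->] /= hCD.
by apply/pp_coset_eq/hP.
Qed.

End PPFormulas.
Arguments pp_lin {R M n} phi p.

(** * Functions modulo those with countable range *)

Section CountablyValuedModel.
Local Open Scope ring_scope.
Variables (R : nzRingType) (M : lmodType R) (X : Type).
Implicit Types (e : nat -> X -> M) (t : mterm R) (p q : mform R).

Fixpoint eval (e : nat -> X -> M) (t : mterm R) (x : X) : M :=
  match t with
  | Var i => e i x
  | Zero => 0
  | Add t1 t2 => eval e t1 x + eval e t2 x
  | Opp t1 => - eval e t1 x
  | Scale r t1 => r *: eval e t1 x
  end.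

(** The quotient module is not formed: elements stay functions and this
    congruence interprets the equality symbol. *)
Definition ctbl_eq (f g : X -> M) : Prop :=
  countable_split (fun x y => f x - g x = f y - g y).

Definition env_cons (f : X -> M) e (i : nat) : X -> M :=
  if i is j.+1 then e j else f.

Fixpoint sat (e : nat -> X -> M) (p : mform R) : Prop :=
  match p with
  | Bot => False
  | Eq t1 t2 => ctbl_eq (eval e t1) (eval e t2)
  | Imp p1 p2 => sat e p1 -> sat e p2
  | All p1 => forall f, sat (env_cons f e) p1
  end.

Definition valid p := forall e, sat e p.

Lemma sat_Neg e p : sat e (Neg p) <-> ~ sat e p.
Proof. by []. Qed.

Lemma sat_And e p q : sat e (And p q) <-> sat e p /\ sat e q.
Proof.
split=> [/= pq|[/= ? ?] pq]; last exact: pq.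
by split; apply: contrapT => npq; apply: pq => // ?.
Qed.

Lemma sat_Ex e p : sat e (Ex p) <-> exists f, sat (env_cons f e) p.
Proof.
split=> [/= ep|[f ep] /= /(_ f)]; last exact.
by apply: contrapT => nex; apply: ep => f ep; apply: nex; exists f.
Qed.

Lemma sat_bigAnd e (I : Type) (s : seq I) (P : pred I) (F : I -> mform R) :
  sat e (\big[@And R/Top]_(i <- s | P i) F i) <->
  foldr (fun i Q => (P i -> sat e (F i)) /\ Q) True s.
Proof.
elim: s => [|i s IH]; first by rewrite big_nil /=; split.
rewrite big_cons /= -IH; case: (P i) => //; last by split=> [|[]].
rewrite sat_And; split=> -[ei es]; split=> //; exact: ei.
Qed.

Lemma sat_bigAnd_ord e k (P : pred 'I_k) (F : 'I_k -> mform R) :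
  sat e (\big[@And R/Top]_(i < k | P i) F i) <-> forall i, P i -> sat e (F i).
Proof.
rewrite sat_bigAnd; split=> [H i|H]; last first.
  by elim: (index_enum _) => //= i s IH; split=> //; exact: H.
have : i \in index_enum 'I_k by rewrite mem_index_enum.
elim: (index_enum _) H => //= j s IH [Hj /IH Hs].
by rewrite inE => /orP[/eqP->|/Hs].
Qed.

Lemma eval_tsubst e (s : nat -> mterm R) t :
  eval e (tsubst s t) = eval (fun i => eval e (s i)) t.
Proof.
by apply/funext => x; elim: t => //= [t1 -> t2 ->|t ->|r t ->].
Qed.

Lemma sat_fsubst e (s : nat -> mterm R) p :
  sat e (fsubst s p) <-> sat (fun i => eval e (s i)) p.
Proof.
elim: p e s => //= [t1 t2|p1 IH1 p2 IH2|p IH] e s.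
- by rewrite !eval_tsubst.
- by rewrite IH1 IH2.
have E f : (fun i => eval (env_cons f e) (slift s i)) =
    env_cons f (fun i => eval e (s i)).
  by apply/funext => -[|i] //=; rewrite /tshift eval_tsubst.
by split=> sp f; have := sp f; rewrite IH E.
Qed.

Lemma eval_tshift e m t : eval e (tshift m t) = eval (fun i => e (m + i)%N) t.
Proof. exact: eval_tsubst. Qed.

Lemma sat_finst e t p : sat e (finst t p) <-> sat (env_cons (eval e t) e) p.
Proof.
rewrite /finst sat_fsubst; set e1 := (fun i => _).
by suff -> : e1 = env_cons (eval e t) e by []; apply/funext => -[].
Qed.

Lemma ctbl_eq_of_eq f g : (forall x, f x = g x) -> ctbl_eq f g.
Proof. by move=> fg; exists (fun=> 0%N) => x y _; rewrite !fg !subrr. Qed.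

Lemma ctbl_eq_sym f g : ctbl_eq f g -> ctbl_eq g f.
Proof.
by apply: countable_split_sub => x y fg; rewrite -opprB fg opprB.
Qed.

Lemma ctbl_eq_trans f g h : ctbl_eq f g -> ctbl_eq g h -> ctbl_eq f h.
Proof.
move=> fg gh; apply: countable_split_sub (countable_split_and fg gh) =>
  x y [E1 E2].
by rewrite -(subrKA (g x)) E1 E2 subrKA.
Qed.

Lemma eval_congr e e' t :
  (forall i, ctbl_eq (e i) (e' i)) -> ctbl_eq (eval e t) (eval e' t).
Proof.
move=> ee'; elim: t => //= [|t1 IH1 t2 IH2|t IH|r t IH].
- exact: ctbl_eq_of_eq.
- apply: countable_split_sub (countable_split_and IH1 IH2) => x y [E1 E2].
  by rewrite !opprD !addrA !(addrAC _ _ (- eval e' t1 _)) E1 -!addrA E2.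
- by apply: countable_split_sub IH => x y E; rewrite -!opprD E.
- by apply: countable_split_sub IH => x y E; rewrite -!scalerBr E.
Qed.

Lemma sat_congr e e' p :
  (forall i, ctbl_eq (e i) (e' i)) -> sat e p <-> sat e' p.
Proof.
elim: p e e' => //= [t1 t2|p1 IH1 p2 IH2|p IH] e e' ee'.
- have E1 := eval_congr t1 ee'; have E2 := eval_congr t2 ee'; split=> E.
    exact: ctbl_eq_trans (ctbl_eq_sym E1) (ctbl_eq_trans E E2).
  exact: ctbl_eq_trans E1 (ctbl_eq_trans E (ctbl_eq_sym E2)).
- by rewrite (IH1 _ _ ee') (IH2 _ _ ee').
have ff' f i : ctbl_eq (env_cons f e i) (env_cons f e' i).
  by case: i => [|i] //=; exact: ctbl_eq_of_eq.
by split=> sp f; apply/(IH _ _ (ff' f)).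
Qed.

Lemma provable_valid (T : set (mform R)) :
  (forall p, T p -> valid p) -> forall p, provable T p -> valid p.
Proof.
move=> Tv p; elim=> {p} [p /Tv //|p q _ pq _ qv e|p _ pv e f|p q e|p q r e|p e
  |p t e|p q e|p e|t e|p t1 t2 e].
- exact: pq (qv e).
- exact: pv.
- by move=> /= ? _.
- by move=> /= H1 H2 H3; apply: H1 => //; apply: H2.
- by move=> /= H; apply: contrapT.
- by move=> /= H; apply/sat_finst.
- by move=> /= H1 H2 f; apply: H1.
- move=> /= H f; rewrite /fshift sat_fsubst; exact: H.
- exact: ctbl_eq_of_eq.
- move=> /= t12; rewrite !sat_finst.
  by rewrite (sat_congr (e' := env_cons (eval e t2) e)) // => -[|i] //=;
    exact: ctbl_eq_of_eq.
Qed.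

Lemma valid_module_axiom p : module_axiom p -> valid p.
Proof.
case=> [||||r s||r|r s] e /= *; apply: ctbl_eq_of_eq => x /=.
- exact: addrA.
- exact: addrC.
- exact: add0r.
- exact: addNr.
- exact: scalerA.
- exact: scale1r.
- exact: scalerDr.
- exact: scalerDl.
Qed.

Definition env_block m (w : nat -> X -> M) e (i : nat) : X -> M :=
  if (i < m)%N then w i else e (i - m)%N.

(** In a block of m existential quantifiers the outermost one binds variable
    m-1, which is why the witnesses come in the order of [env_block]. *)
Lemma sat_iter_Ex m e p :
  sat e (iter m (@Ex R) p) <-> exists w, sat (env_block m w e) p.
Proof.
elim: m e p => [|m IH] e p.
  suff E w : env_block 0 w e = e by split=> [ep|[w]]; [exists e|]; rewrite E.
  by apply/funext => i; rewrite /env_block subn0.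
rewrite iterS sat_Ex; split=> [[f /IH[w wp]]|[w wp]].
  exists (fun i => if i == m then f else w i).
  congr (sat _ p): wp; apply/funext => i; rewrite /env_block ltnS.
  case: (ltngtP i m) => [//|mi|->]; last by rewrite subnn.
  by rewrite -(subnSK mi).
exists (w m); apply/IH; exists w.
congr (sat _ p): wp; apply/funext => i; rewrite /env_block ltnS.
case: (ltngtP i m) => [//|mi|->]; last by rewrite subnn.
by rewrite -(subnSK mi).
Qed.

(** Purity of the functions with countable range. If the defects of u and w in
    the equations of phi have countable range, then wherever these defects
    agree the difference of the witnesses shows that the values of u are
    congruent modulo phi(M). Conversely, if u meets countably many cosets,
    then u differs by an element of phi(M), hence with pointwise witnesses and
    no defect, from a function with countable range. *)
Lemma sat_pp_form e n (phi : ppform R n) (t : 'I_n -> mterm R) :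
  sat e (pp_form phi t) <->
  countable_split (fun x y =>
    pp_sol phi M ((\row_j eval e (t j) x) - (\row_j eval e (t j) y))).
Proof.
set u := fun x => \row_j eval e (t j) x : 'rV[M]_n.
have evalE w x i : let e' := env_block (pp_ex phi) w e in
    eval e' (Add (\big[@Add R/Zero]_(j < n)
                    Scale (pp_free phi i j) (tshift (pp_ex phi) (t j)))
                 (\big[@Add R/Zero]_(j < pp_ex phi)
                    Scale (pp_bound phi i j) (Var j))) x =
    pp_lin phi (u x, \row_j w j x) 0 i.
  move=> e'; rewrite mxE /=.
  rewrite !(big_morph (fun t => eval e' t x) (id1 := 0) (op1 := +%R)) //=.
  congr (_ + _); apply: eq_bigr => j _; rewrite !mxE;
    last by rewrite /e' /env_block ltn_ord.
  rewrite eval_tshift; congr (_ *: eval _ _ x); apply/funext => k.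
  by rewrite /e' /env_block ltnNge leq_addr /= addKn.
rewrite /pp_form sat_iter_Ex;
  split=> [[w /sat_bigAnd_ord sw]|/countable_split_rep[rep [srep repP]]].
  have {}sw i : countable_split (fun x y => pp_lin phi (u x, \row_j w j x) 0 i
     = pp_lin phi (u y, \row_j w j y) 0 i).
    by apply: countable_split_sub (sw i isT) => x y;
      rewrite /= -!evalE /= !subr0.
  apply: countable_split_sub (countable_split_forall sw) => x y Exy.
  apply/pp_solP; exists ((\row_j w j x) - (\row_j w j y)).
  rewrite pp_linB.
  by apply/eqP; rewrite subr_eq0; apply/eqP/rowP.
have /choice[w wP] : forall x, exists w, pp_lin phi (u x - u (rep x), w) = 0.
  by move=> x; apply/pp_solP/repP.
(* Variable j holds the j-th witness for j < pp_ex phi. *)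
exists (fun j x => if insub j is Some j' then w x 0 j' else 0).
apply/sat_bigAnd_ord => i _; apply: countable_split_sub srep => x y Exy.
rewrite !evalE /= !subr0.
suff E z : pp_lin phi (u z,
  \row_j (if insub (val j) is Some j' then w z 0 j' else 0))
   = pp_lin phi (u (rep z), 0) by rewrite !E Exy.
have -> : \row_j (if insub (val j) is Some j' then w z 0 j' else 0) = w z.
  by apply/rowP => j; rewrite mxE valK.
have := wP z; rewrite -{1}[w z]subr0 pp_linB.
by move=> /eqP; rewrite subr_eq0 => /eqP.
Qed.

(** The k * n variables of the formula are regrouped as k functions with
    values in M^n. *)
Lemma sat_index_ge e n (phi psi : ppform R n) k :
  sat e (index_ge phi psi k) <->
  exists u : nat -> X -> 'rV[M]_n,
    (forall i, (i < k)%N ->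
       countable_split (fun x y => pp_sol phi M (u i x - u i y))) /\
    (forall i j, (i < j < k)%N -> ~ countable_split
       (fun x y => pp_sol psi M ((u i x - u j x) - (u i y - u j y)))).
Proof.
rewrite /index_ge sat_iter_Ex.
transitivity (exists w : nat -> X -> M,
    let u i x : 'rV[M]_n := \row_(l < n) w (i * n + l)%N x in
    (forall i : 'I_k, countable_split (fun x y =>
      pp_sol phi M (u i x - u i y))) /\
    (forall i j : 'I_k, (i < j)%N -> ~ countable_split
       (fun x y => pp_sol psi M ((u i x - u j x) - (u i y - u j y))))).
  have wE w (i : 'I_k) (l : 'I_n) :
      env_block (k * n) w e (i * n + l) = w (i * n + l)%N.
    rewrite /env_block ifT //; apply: (@leq_trans (i.+1 * n)).
      by rewrite mulSn addnC ltn_add2r.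
    by rewrite leq_mul2r ltn_ord orbT.
  have rE w (i j : 'I_k) x :
      \row_(l < n) eval (env_block (k * n) w e)
         (Add (Var (i * n + l)) (Opp (Var (j * n + l)))) x =
      \row_(l < n) w (i * n + l)%N x - \row_(l < n) w (j * n + l)%N x.
    by apply/rowP => l; rewrite !mxE /= !wE.
  split=> [[w /sat_And[/sat_bigAnd_ord H1 /sat_bigAnd_ord H2]]|[w [H1 H2]]];
    exists w;
    [split=> [i|i j ij]|apply/sat_And; split; apply/sat_bigAnd_ord => i _].
  - have /sat_pp_form := H1 i isT; apply: countable_split_sub => x y.
    by congr (pp_sol _ _ (_ - _)); apply/rowP => l; rewrite !mxE /= wE.
  - have /sat_bigAnd_ord/(_ j ij)/sat_Neg/sat_pp_form := H2 i isT.
    by apply: contra_not; apply: countable_split_sub => x y; rewrite !rE.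
  - apply/sat_pp_form; apply: countable_split_sub (H1 i) => x y.
    by congr (pp_sol _ _ (_ - _)); apply/rowP => l; rewrite !mxE /= wE.
  - apply/sat_bigAnd_ord => j ij; apply/sat_Neg => /sat_pp_form S.
    by apply: (H2 i j ij); apply: countable_split_sub S => x y; rewrite !rE.
split=> [[w [H1 H2]]|[u [H1 H2]]].
  exists (fun i x => \row_(l < n) w (i * n + l)%N x);
    split=> [i ik|i j /andP[ij jk]].
    exact: H1 (Ordinal ik).
  exact: (H2 (Ordinal (ltn_trans ij jk)) (Ordinal jk) ij).
(* Variable i * n + l holds the l-th entry of the i-th tuple. *)
exists (fun v x =>
  if insub (v %% n)%N is Some l then u (v %/ n)%N x 0 l else 0).
have uE (i : nat) x : \row_(l < n)
    (if insub ((i * n + l) %% n)%N is Some l' then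
       u ((i * n + l) %/ n)%N x 0 l' else 0) = u i x.
  apply/rowP => l; rewrite mxE modnMDl modn_small // valK.
  by rewrite divnMDl ?divn_small ?addn0 // (leq_ltn_trans _ (ltn_ord l)).
split=> [i|i j ij].
  by have := H1 i (ltn_ord i); apply: countable_split_sub => x y; rewrite !uE.
by move=> S; apply: (H2 i j);
  [rewrite ij ltn_ord|apply: countable_split_sub S => x y; rewrite !uE].
Qed.

End CountablyValuedModel.

(** * Consistency of the theory *)

Section Consistency.
Local Open Scope ring_scope.
Variables (R : nzRingType) (M : lmodType R).

(** The first coordinate of X = nat * M^nat makes room for infinitely many
    functions with disjoint supports, and the second one is large enough to
    enumerate phi(M) for every number n of variables at once. The i-th
    function runs through phi(M) on the slice x.1 = i and vanishes elsewhere,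
    so the difference of two of them meets all cosets of psi(M) in phi(M). *)
Lemma valid_index_ge n (phi psi : ppform R n) k :
  ~ countable (pp_cosets phi psi M) ->
  valid M (nat * (nat -> M)) (index_ge phi psi k).
Proof.
move=> unctbl e; apply/sat_index_ge.
pose g (y : nat -> M) : 'rV[M]_n :=
  if `[< pp_sol phi M (\row_l y l) >] then \row_l y l else 0.
have gP y : pp_sol phi M (g y).
  by rewrite /g; case: asboolP => // _; exact: pp_sol0.
exists (fun i x => if x.1 == i then g x.2 else 0);
  split=> [i _|i j /andP[ij _] [h hP]].
  exists (fun=> 0%N) => x y _.
  by apply: pp_solB; case: ifP => // _; exact: pp_sol0.
apply: unctbl; apply/countable_cosetsP.
pose ext (u : 'rV[M]_n) (l : nat) : M :=
  if insub l is Some l' then u 0 l' else 0.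
have gE u : pp_sol phi M u -> g (ext u) = u.
  have E : \row_(l < n) ext u l = u by apply/rowP => l; rewrite mxE /ext valK.
  by rewrite /g E; case: asboolP.
exists (fun u => h (i, ext u)) => u v uP vP /hP /=.
by rewrite eqxx (ltn_eqF ij) !subr0 !gE.
Qed.

(** A function which meets countably many cosets of phi(M) meets countably
    many cosets of psi(M), because each coset of phi(M) is covered by
    countably many cosets of psi(M). So phi implies psi in the model. *)
Lemma valid_index_one n (phi psi : ppform R n) X :
  countable (pp_cosets phi psi M) ->
  valid M X (Neg (index_gt1 phi psi)).
Proof.
move=> /countable_cosetsP[c cP] e; apply/sat_Neg => /sat_index_ge[u [H1 H2]].
apply: (H2 0 1)%N => //; set v := fun x => u 0%N x - u 1%N x.
have /countable_split_rep[rep [[h hP] repP]] :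
    countable_split (fun x y => pp_sol phi M (v x - v y)).
  have := countable_split_and (H1 0 isT)%N (H1 1 isT)%N;
    apply: countable_split_sub.
  by move=> x y [P0 P1]; rewrite /v opprD addrACA -opprD; exact: pp_solB.
apply: (countable_split_by (h := fun x => (h x, c (v x - v (rep x))))) =>
  x y [/hP rxy].
move=> /(cP _ _ (repP x) (repP y)).
suff -> : v x - v (rep x) - (v y - v (rep y)) = v x - v y by [].
have subBB (a b d : 'rV[M]_n) : a - d - (b - d) = a - b by rewrite opprB subrKA.
by rewrite rxy subBB.
Qed.

Lemma Th_Pun_consistent : ~ provable (Th_Pun M) Bot.
Proof.
move=> /(provable_valid (M := M) (X := nat * (nat -> M))) H.
apply: (H _ (fun _ _ => 0)) =>
  p [q /valid_module_axiom|n phi psi k _|n phi psi _].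
- exact.
- exact: valid_index_ge.
- exact: valid_index_one.
Qed.

End Consistency.

(** * Polish groups *)

Lemma dependent_choice_nat (S : Type) (I : nat -> S -> Prop)
    (R : nat -> S -> S -> Prop) (s0 : S) :
  I 0%N s0 -> (forall n s, I n s -> exists s', I n.+1 s' /\ R n s s') ->
  exists u : nat -> S, u 0%N = s0 /\ forall n, I n (u n) /\ R n (u n) (u n.+1).
Proof.
move=> I0 step.
have /choice[g gP] : forall ns : nat * S, exists s',
    I ns.1 ns.2 -> I ns.1.+1 s' /\ R ns.1 ns.2 s'.
  move=> [n s]; have [/step[s' ss']|nI] := pselect (I n s); first by exists s'.
  by exists s.
pose u := fix u n := if n is m.+1 then g (m, u m) else s0.
have uI n : I n (u n) by elim: n => [//|n /(gP (n, u n))[]].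
by exists u; split=> // n; split=> //; have [] := gP (n, u n) (uI n).
Qed.

Section PolishGroups.
Local Open Scope ring_scope.

(** A Polish group topology described by the entourages E k = (d < 2^-k) of a
    complete metric d. Real numbers disappear, and separability and
    completeness take forms which pass to closed subgroups and to products by
    inspection. The metric is not assumed invariant, so the E k need not be
    invariant under translations. *)
Record polish_uniformity (G : zmodType) (E : nat -> G -> G -> Prop) : Prop := {
  pu_refl : forall k x, E k x x;
  pu_sym : forall k x y, E k x y -> E k y x;
  pu_half : forall k x y z, E k.+1 x y -> E k.+1 y z -> E k x z;
  pu_separated : forall x y, (forall k, E k x y) -> x = y;
  pu_complete : forall u : nat -> G, (forall k, E k.+2 (u k) (u k.+1)) ->
    exists l, forall k, E k (u k) l;
  pu_split : forall k, countable_split (E k);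
  pu_sub : forall x y k, exists j, forall x' y',
    E j x x' -> E j y y' -> E k (x - y) (x' - y')
}.

Definition cts (G H : Type) (E : nat -> G -> G -> Prop)
    (F : nat -> H -> H -> Prop) (f : G -> H) : Prop :=
  forall x k, exists j, forall y, E j x y -> F k (f x) (f y).

Section OneGroup.
Variables (G : zmodType) (E : nat -> G -> G -> Prop).
Hypothesis PE : polish_uniformity E.
Implicit Types (x y z : G) (S T : G -> Prop).

Definition is_nbhd S z : Prop := exists k, forall x, E k z x -> S x.
Definition adherent S z : Prop := forall k, exists x, S x /\ E k z x.

Lemma near_le j k x y : (j <= k)%N -> E k x y -> E j x y.
Proof.
move=> /subnK <-; elim: (k - j)%N => [//|i IH]; rewrite addSn => Exy.
by apply/IH/(pu_half PE Exy)/(pu_refl PE).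
Qed.

Lemma nbhd_sub S T z : (forall x, S x -> T x) -> is_nbhd S z -> is_nbhd T z.
Proof. by move=> ST [k kS]; exists k => x /kS/ST. Qed.

Lemma nbhd_self S z : is_nbhd S z -> S z.
Proof. by case=> k; apply; exact: (pu_refl PE). Qed.

Lemma nbhd_idem S z : is_nbhd S z -> is_nbhd (is_nbhd S) z.
Proof.
move=> [k kS]; exists k.+1 => x zx; exists k.+1 => y xy.
by apply/kS/(pu_half PE zx).
Qed.

Lemma adherent_nbhd S T z : adherent S z -> is_nbhd T z -> exists x, S x /\ T x.
Proof. by move=> cS [k kT]; have [x [Sx /kT Tx]] := cS k; exists x. Qed.

Lemma adherent_idem S z : adherent (adherent S) z -> adherent S z.
Proof.
move=> cS k; have [x [/(_ k.+1)[y [Sy xy]] zx]] := cS k.+1.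
by exists y; split=> //; apply: pu_half PE _ _ _ _ zx xy.
Qed.

Lemma not_adherent_nbhd S z :
  ~ adherent S z -> is_nbhd (fun x => ~ adherent S x) z.
Proof.
move=> nS; apply: contrapT => nI; apply: nS; apply: adherent_idem => k.
apply: contrapT => nk; apply: nI; exists k => x zx cS; apply: nk.
by exists x.
Qed.

Lemma sub_cts x y k : exists j, forall z, E j y z -> E k (x - y) (x - z).
Proof.
have [j jP] := pu_sub PE x y k.
by exists j => z yz; apply: jP yz; exact: (pu_refl PE).
Qed.

Lemma subl_cts a : cts E E (fun x => a - x).
Proof. by move=> x k; exact: sub_cts. Qed.

Lemma subr_cts a : cts E E (fun x => x - a).
Proof.
move=> x k; have [j jP] := pu_sub PE x a k.
by exists j => z xz; apply: jP => //; exact: (pu_refl PE).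
Qed.

Lemma addr_cts a : cts E E (fun x => x + a).
Proof.
move=> x k; have [j jP] := subr_cts (- a) x k.
by exists j => y /jP; rewrite !opprK.
Qed.

Lemma addl_cts a : cts E E (fun x => a + x).
Proof.
move=> x k; have [j jP] := addr_cts a x k.
by exists j => y; rewrite ![a + _]addrC => /jP.
Qed.

(** The Lindelof property: on the points x whose neighbourhood O x contains
    the E j-ball with the same j, a countable partition of mesh E j will
    do. *)
Lemma countable_split_nbhs (O : G -> G -> Prop) :
  (forall x, is_nbhd (O x) x) -> countable_split O.
Proof.
move=> /choice[j jO]; have /choice[h hE] := pu_split PE.
by apply: (countable_split_by (h := fun x => (j x, h (j x) x))) => x y [jxy];
  rewrite -jxy => /hE/jO.
Qed.

(** The closeness to the limit is controlled by the same indices j n as the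
    steps; this is what transfers conditions imposed at stage n to the
    limit. *)
Lemma lim_seq (u : nat -> G) (j : nat -> nat) :
  (forall n, (j n < j n.+1)%N) -> (forall n, E (j n).+2 (u n) (u n.+1)) ->
  exists l, forall n, E (j n) (u n) l.
Proof.
move=> jlt uE.
have jge n : (n <= j n)%N by elim: n => // n IH;
  exact: leq_ltn_trans IH (jlt n).
have [|l lP] := pu_complete PE (u := u).
  by move=> k; apply: near_le (uE k); rewrite !ltnS.
exists l => n.
have chain m : forall i, E (j i).+1 (u i) (u (i + m)%N).
  elim: m => [|m IH] i; first by rewrite addn0; exact: (pu_refl PE).
  apply: (pu_half PE (uE i)); rewrite -addSnnS; apply: near_le (IH i.+1).
  by rewrite !ltnS.
apply: (pu_half PE (chain (j n).+1 n)); apply: near_le (lP _).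
exact: leq_addl.
Qed.

Lemma common_radius (J : eqType) (s : seq J) (P : J -> nat -> Prop) :
  (forall i k k', (k <= k')%N -> P i k -> P i k') ->
  (forall i, i \in s -> exists k, P i k) ->
  exists k, forall i, i \in s -> P i k.
Proof.
move=> Pmono; elim: s => [|i s IH] Ps; first by exists 0%N.
have [k kP] := Ps i (mem_head _ _).
have [j js|k' k'P] := IH; first by apply: Ps; rewrite inE js orbT.
exists (maxn k k') => j; rewrite inE => /orP[/eqP->|/k'P].
  exact: Pmono (leq_maxl _ _) kP.
exact/Pmono/leq_maxr.
Qed.

Definition nowhere_dense S : Prop :=
  forall x k, exists y, E k x y /\ is_nbhd (fun z => ~ S z) y.

Lemma nowhere_dense_preim S (h h' : G -> G) : cancel h' h -> cancel h h' ->
  cts E E h -> cts E E h' ->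
  nowhere_dense S -> nowhere_dense (fun x => S (h x)).
Proof.
move=> h'K hK hc h'c rS x k.
have [j jP] := h'c (h x) k; have [y [/jP xy [i iP]]] := rS (h x) j.
exists (h' y); split; first by rewrite -[x]hK.
have [l lP] := hc (h' y) i; exists l => z /lP; rewrite h'K; exact: iP.
Qed.

Lemma baire (I : countType) (S : I -> G -> Prop) :
  (forall i, nowhere_dense (S i)) ->
  forall x k, exists y, E k x y /\ forall i, ~ S i y.
Proof.
move=> Srare x k.
have [||u [u0 uP]] := @dependent_choice_nat (G * nat) (fun _ _ => True)
  (fun n s s' => [/\ E s.2.+2 s.1 s'.1, (s.2 < s'.2)%N &
     forall i, unpickle n = Some i ->
       forall z, E s'.2 s'.1 z -> ~ S i z]) (x, k).
- by [].
(* Stage n moves into a ball disjoint from the set with code n, if any. *)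
- move=> n [y j] _ /=; case nI : (unpickle n) => [i|]; last first.
    exists (y, j.+1); split=> //; split=> //=; exact: (pu_refl PE).
  have [y' [yy' [j' j'P]]] := Srare i y j.+2.
  exists (y', maxn j.+1 j'); split=> //; split=> //=; first exact: leq_maxl.
  by move=> _ [<-] z /(near_le (leq_maxr _ _))/j'P.
have {uP}uP n := (uP n).2.
have [||l lP] := @lim_seq (fun n => (u n).1) (fun n => (u n).2).
- by move=> n; have [] := uP n.
- by move=> n; have [] := uP n.
exists l; split; first by have := lP 0%N; rewrite u0.
move=> i; have [_ _] := uP (pickle i); apply; last exact: lP.
exact: pickleK.
Qed.

End OneGroup.

Lemma cts_nbhd (G H : zmodType) (E : nat -> G -> G -> Prop)
    (F : nat -> H -> H -> Prop) (f : G -> H) (S : H -> Prop) x :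
  cts E F f -> is_nbhd F S (f x) -> is_nbhd E (fun y => S (f y)) x.
Proof. by move=> fc [k kS]; have [j jP] := fc x k; exists j => y /jP/kS. Qed.

Lemma cts_adherent (G H : zmodType) (E : nat -> G -> G -> Prop)
    (F : nat -> H -> H -> Prop) (f : G -> H) S (T : H -> Prop) x :
  cts E F f -> (forall y, S y -> T (f y)) ->
  adherent E S x -> adherent F T (f x).
Proof.
move=> fc ST cS k; have [j jP] := fc x k.
by have [y [Sy /jP xy]] := cS j; exists (f y); split=> //; exact: ST.
Qed.

(** Closure commutes with differences, by continuity of subtraction. *)
Lemma adherent_subG (G : zmodType) (E : nat -> G -> G -> Prop)
    (S T : G -> Prop) x y :
  polish_uniformity E ->
  (forall a b, S a -> S b -> T (a - b)) -> adherent E S x -> adherent E S y ->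
  adherent E T (x - y).
Proof.
move=> PE ST cx cy k; have [j jP] := pu_sub PE x y k.
have [a [Sa xa]] := cx j; have [b [Sb yb]] := cy j.
by exists (a - b); split; [exact: ST|exact: jP].
Qed.

(** * Many elements with differences outside a meagre set *)

Section PerfectSet.
Variables (G : zmodType) (E : nat -> G -> G -> Prop).
Hypothesis PE : polish_uniformity E.
Variable N : nat -> G -> Prop.
Hypothesis N_rare : forall i, nowhere_dense E (N i).
Hypothesis N_closed : forall i x, ~ N i x -> is_nbhd E (fun y => ~ N i y) x.

(** The elements g to be avoided lie in countably many translates and
    reflections of the nowhere dense sets N i, and the closeness conditions
    hold for all g near 0, so Baire's theorem provides g. *)
Lemma small_generic (T : seq G) k : exists g,
  forall t, t \in T ->
    [/\ E k t (t + g), E k t (t - g),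
        (forall i, ~ N i (t + g)) & forall i, ~ N i (t - g)].
Proof.
have [j jP] : exists j, forall t, t \in T -> forall g,
    E j 0 g -> E k t (t + g) /\ E k t (t - g).
  apply: common_radius => [t j j' jj' jP g /(near_le PE jj')/jP//|t _].
  have [j1 j1P] := addl_cts PE t 0 k; have [j2 j2P] := subl_cts PE t 0 k.
  exists (maxn j1 j2) => g g0; split.
    by have := j1P g (near_le PE (leq_maxl _ _) g0); rewrite addr0.
  by have := j2P g (near_le PE (leq_maxr _ _) g0); rewrite subr0.
(* An index (i, m, b) stands for a set N i, a position m in T and a sign b. *)
pose S (c : nat * nat * bool) g := let t := nth 0 T c.1.2 in
  N c.1.1 (if c.2 then t + g else t - g).
have [] := @baire G E PE _ S _ 0 j.
  move=> [[i m] []]; rewrite /S /=; set t := nth _ _ _.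
    apply: (nowhere_dense_preim (h := fun x => t + x)
      (h' := fun x => x - t)) (N_rare i).
    - by move=> x; rewrite addrC subrK.
    - by move=> x; rewrite addrC addKr.
    - exact: addl_cts.
    - exact: subr_cts.
  apply: (nowhere_dense_preim (h := fun x => t - x)
    (h' := fun x => t - x)) (N_rare i).
  - by move=> x; rewrite subKr.
  - by move=> x; rewrite subKr.
  - exact: subl_cts.
  - exact: subl_cts.
move=> g [g0 gP]; exists g => t tT; have [tg tg'] := jP t tT g g0.
split=> // i.
  by have := gP (i, index t T, true); rewrite /S /= nth_index.
by have := gP (i, index t T, false); rewrite /S /= nth_index.
Qed.

(** For a : nat -> bool let c a be the sum of the g n with a n = true. At
    stage n the list T contains all combinations of the earlier g's with
    coefficients in {-1, 0, 1} that can be the difference of two distinct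
    partial sums. The next g keeps all of them outside every N i; it is so
    small that the elements of T keep, up to the limit, their distance from
    the first n of the N i. *)
Lemma perfect_difference_set : exists c : (nat -> bool) -> G,
  forall a b, a <> b -> forall i, ~ N i (c a - c b).
Proof.
pose next (T : seq G) g :=
  T ++ [seq t + g | t <- 0 :: T] ++ [seq t - g | t <- 0 :: T].
pose Inv n (s : G * seq G * nat) :=
  (forall t i, t \in s.1.2 -> ~ N i t) /\
  forall i, (i < n)%N -> forall t, t \in s.1.2 ->
    forall z, E s.2 t z -> ~ N i z.
pose Next (n : nat) (s s' : G * seq G * nat) :=
  [/\ (s.2 < s'.2)%N, s'.1.2 = next s.1.2 s'.1.1 &
     forall t, t \in 0 :: s.1.2 ->
       E s.2.+2 t (t + s'.1.1) /\ E s.2.+2 t (t - s'.1.1)].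
have [||u [u0 uP]] := @dependent_choice_nat _ Inv Next (0, [::], 0%N).
- by [].
- move=> n [[g T] k] [/= TN _]; have [g' g'P] := small_generic (0 :: T) k.+2.
  have T'N t i : t \in next T g' -> ~ N i t.
    rewrite !mem_cat => /or3P[/TN|/mapP[s sT ->]|/mapP[s sT ->]]; first exact.
      by have [_ _ + _] := g'P s sT; apply.
    by have [_ _ _] := g'P s sT; apply.
  have [k' k'P] : exists k', forall i, i \in iota 0 n.+1 ->
      forall t, t \in next T g' -> forall z, E k' t z -> ~ N i z.
    apply: common_radius => [i j j' jj' jP t tT z /(near_le PE jj')|i _];
      first exact: jP.
    apply: common_radius => [t j j' jj' jP z /(near_le PE jj')|t /T'N];
      first exact: jP.
    by move=> /(_ i)/N_closed.
  exists (g', next T g', maxn k.+1 k'); split; split=> //=.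
  + by move=> i ni t tT z /(near_le PE (leq_maxr _ _)); apply: k'P;
      rewrite ?mem_iota.
  + exact: leq_maxl.
  + by move=> t /g'P[].
pose g n := (u n.+1).1.1; pose T n := (u n).1.2; pose k n := (u n).2.
have klt n : (k n < k n.+1)%N by have [_ []] := uP n.
have kge n : (n <= k n)%N by elim: n => // n IH;
  exact: leq_ltn_trans IH (klt n).
have T1 n : T n.+1 = next (T n) (g n) by have [_ []] := uP n.
have gE n t : t \in 0 :: T n ->
    E (k n).+2 t (t + g n) /\ E (k n).+2 t (t - g n).
  by have [_ [_ _]] := uP n; apply.
have TN n i t z : (i < n)%N -> t \in T n -> E (k n) t z -> ~ N i z.
  by move=> ni tT; have [[_ +] _] := uP n; apply.
pose c (a : nat -> bool) n := \sum_(i < n) (if a i then g i else 0).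
have cS a n : c a n.+1 = c a n + (if a n then g n else 0).
  by rewrite /c big_ord_recr.
pose d a b n := c a n - c b n.
have dS a b n :
    [\/ d a b n.+1 = d a b n /\ a n = b n,
        d a b n.+1 = d a b n + g n | d a b n.+1 = d a b n - g n].
  rewrite /d !cS; case: (a n); case: (b n).
  - by constructor 1; rewrite opprD addrACA subrr addr0.
  - by constructor 2; rewrite addr0 addrAC.
  - by constructor 3; rewrite addr0 opprD addrA.
  - by constructor 1; rewrite !addr0.
have dT a b n : d a b n \in 0 :: T n.
  elim: n => [|n IH]; first by rewrite /d /c !big_ord0 subrr mem_head.
  rewrite T1 /next in_cons !mem_cat; have [[-> _]|->|->] := dS a b n.
  - by move: IH; rewrite in_cons => /orP[->|->] //; rewrite orbT.
  - by rewrite (map_f (fun t => t + g n) IH) !orbT.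
  - by rewrite (map_f (fun t => t - g n) IH) !orbT.
have dT1 a b n : a n <> b n -> d a b n.+1 \in T n.+1.
  rewrite T1 /next !mem_cat => ab; have [[_ /ab//]|->|->] := dS a b n.
  - by rewrite (map_f (fun t => t + g n) (dT a b n)) !orbT.
  - by rewrite (map_f (fun t => t - g n) (dT a b n)) !orbT.
have dT' a b n m : a n <> b n -> (n < m)%N -> d a b m \in T m.
  move=> ab /subnK <-; elim: (m - n.+1)%N => [|j IH]; first exact: dT1.
  rewrite addSn T1 /next !mem_cat; have [[-> _]|->|->] := dS a b (j + n.+1)%N.
  - by rewrite IH.
  - by rewrite (map_f (fun t => t + g _) (dT a b _)) !orbT.
  - by rewrite (map_f (fun t => t - g _) (dT a b _)) !orbT.
have dE a b n : E (k n).+2 (d a b n) (d a b n.+1).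
  have [H1 H2] := gE n _ (dT a b n); have [[-> _]|->|->] := dS a b n => //.
  exact: (pu_refl PE).
have dlim a b := lim_seq PE klt (dE a b).
(* c a is its difference with c z, so its convergence is a case of dlim. *)
pose z (_ : nat) := false.
have dz a n : d a z n = c a n by rewrite /d {2}/c big1 ?subr0.
have /choice[C CP] : forall a, exists l, forall n, E (k n) (c a n) l.
  by move=> a; have [l lP] := dlim a z; exists l => n; rewrite -dz.
exists C => a b ab i.
have [m abm] : exists m, a m <> b m.
  by apply: contrapT => nab; apply: ab; apply/funext => m;
    apply: contrapT => abm; apply: nab; exists m.
have [l lP] := dlim a b.
suff -> : C a - C b = l.
  apply: (TN (maxn i m).+1 i (d a b (maxn i m).+1));
    first by rewrite ltnS leq_maxl.
    by apply: dT' abm _; rewrite ltnS leq_maxr.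
  exact: lP.
apply: (pu_separated PE) => r; have [j jP] := pu_sub PE (C a) (C b) r.+1.
pose n := maxn j r.+1.
have nE q q' s : (q <= n)%N -> E (k n) s q' -> E q s q'.
  by move=> qn sq'; have := near_le PE (leq_trans qn (kge n)) sq'.
apply: (pu_half PE (y := d a b n)).
  by apply: jP; apply: (pu_sym PE); apply: (nE _ _ _ (leq_maxl _ _)); exact: CP.
exact: (nE _ _ _ (leq_maxr _ _)).
Qed.

End PerfectSet.

(** * The index of a continuous homomorphic image *)

Section ImageIndex.
Variables (G H : zmodType).
Variables (E : nat -> G -> G -> Prop) (F : nat -> H -> H -> Prop).
Hypotheses (PE : polish_uniformity E) (PF : polish_uniformity F).
Variable f : {additive H -> G}.
Hypothesis f_cts : cts F E f.

Definition ball_image k q (z : G) : Prop := exists q', F k q q' /\ f q' = z.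

Lemma nbhd_adherent_ball_image :
  (forall k, is_nbhd E (adherent E (ball_image k 0)) 0) ->
  forall k q, is_nbhd E (adherent E (ball_image k q)) (f q).
Proof.
move=> H0 k q; have [j jP] := addr_cts PF q 0 k.
have /(cts_nbhd (x := f q) (subr_cts PE (f q))) :
    is_nbhd E (adherent E (ball_image j 0)) (f q - f q).
  by rewrite subrr.
apply: nbhd_sub => z cz; rewrite -(subrK (f q) z).
apply: (cts_adherent (addr_cts PE (f q))) cz => y [q' [/jP]];
  rewrite add0r => qq' <-.
by exists (q' + q); rewrite raddfD.
Qed.

(** A back-and-forth between two points of H. Let C k q be the closure of the
    image of the k-ball around q; by translation it is a neighbourhood of f q.
    If y is in the interior of C 2 0, points s n and t n are chosen
    alternately so that y - f (t n) stays in the interior of C (n + 2) (s n).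
    At each step f of a point near s n approximates y - f (t n), and then f of
    a point near t n approximates y - f of the new s. Both sequences converge
    and their limits q, q' satisfy f q = y - f q'. With a single sequence the
    size of a correction would have to be fixed before the point to which it
    is added, which would need an invariant metric. *)
Lemma open_mapping :
  (forall k, is_nbhd E (adherent E (ball_image k 0)) 0) ->
  is_nbhd E (fun y => exists q, y = f q) 0.
Proof.
move=> /nbhd_adherent_ball_image If.
suff : is_nbhd E (is_nbhd E (adherent E (ball_image 2 0))) 0.
  apply: nbhd_sub => y Iy.
  pose Inv n (st : H * H) :=
    is_nbhd E (adherent E (ball_image n.+2 st.1)) (y - f st.2).
  have [||u [_ uP]] := @dependent_choice_nat _ Inv (fun n st st' =>
      F n.+2 st.1 st'.1 /\ F n.+2 st.2 st'.2) (0, 0).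
  - by rewrite /Inv /= raddf0 subr0.
  - move=> n [s t] /(nbhd_self PE)/= cs.
    have It : is_nbhd E (fun z =>
      is_nbhd E (adherent E (ball_image n.+2 t)) (y - z)) (y - f t).
      by apply: (cts_nbhd (subl_cts PE y)); rewrite subKr;
        apply/(nbhd_idem PE)/If.
    have [_ [[s' [ss' <-]] Is]] := adherent_nbhd cs It.
    have Is' : is_nbhd E (fun z =>
      is_nbhd E (adherent E (ball_image n.+3 s')) (y - z)) (y - f s').
      by apply: (cts_nbhd (subl_cts PE y)); rewrite subKr;
        apply/(nbhd_idem PE)/If.
    have [_ [[t' [tt' <-]] It']] := adherent_nbhd (nbhd_self PE Is) Is'.
    by exists (s', t').
  have [q qP] := pu_complete PF (fun n => (uP n).2.1).
  have [q' q'P] := pu_complete PF (fun n => (uP n).2.2).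
  exists (q + q'); rewrite raddfD; apply: (addIr (- f q')); rewrite addrK.
  apply/esym/(pu_separated PE) => r.
  have [j jP] := f_cts q r.+2.
  have [i iP] : exists i, forall x, F i q' x -> E r.+1 (y - f q') (y - f x).
    have [i1 i1P] := subl_cts PE y (f q') r.+1.
    by have [i iP] := f_cts q' i1; exists i => x /iP/i1P.
  pose n := maxn j.+1 i.
  have /(nbhd_self PE)/(_ r.+2)[_ [[x [sx <-]] yx]] := (uP n).1.
  have qx : F j q x.
    apply: (pu_half PF (y := (u n).1)).
      by apply/(pu_sym PF)/(near_le PF (leq_maxl _ _)); exact: qP.
    by apply: (near_le PF _ sx);
      rewrite (leq_trans (leq_maxl j.+1 i)) // -addn2 leq_addr.
  apply: (pu_half PE (y := y - f (u n).2)).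
    apply: (pu_half PE (jP x qx)); exact: (pu_sym PE).
  apply/(pu_sym PE)/iP/(pu_sym PF)/(near_le PF (leq_maxr _ _)); exact: q'P.
by have := If 2 0; rewrite raddf0 => /(nbhd_idem PE).
Qed.

(** When f(H) is not open, the difference of two elements of one piece of H
    lies in a ball whose image has a closure that is not a neighbourhood of 0;
    so the closure N i of the image of the piece is nowhere dense, since
    otherwise N i - N i would be a neighbourhood of 0 inside that closure. *)
Theorem image_index_dichotomy :
  countable_split (fun x y => exists q, x - y = f q) \/
  exists c : (nat -> bool) -> G, forall a b, a <> b ->
    ~ exists q, c a - c b = f q.
Proof.
have [|/existsNP[k nI]] :=
  pselect (forall k, is_nbhd E (adherent E (ball_image k 0)) 0).
  move=> /open_mapping f_open; left; apply: (countable_split_nbhs PE) => x.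
  apply: (cts_nbhd (S := fun y => exists q, y = f q) (subl_cts PE x)).
  by rewrite subrr.
right.
have [h hP] : countable_split (fun q q' => F k 0 (q' - q)).
  apply: (countable_split_nbhs PF) => q;
    apply: (cts_nbhd (S := F k 0) (subr_cts PF q)).
  by rewrite subrr; exists k.
pose N i := adherent E (fun z => exists q, h q = i /\ f q = z).
have [i x||c cP] := @perfect_difference_set G E PE N; last 1 first.
- exists c => a b /cP ab [q cabq]; apply: (ab (h q)) => j.
  by exists (f q); split; [exists q|rewrite cabq; exact: (pu_refl PE)].
- move=> m; apply: contrapT => nr; apply: nI.
  have cN y : E m x y -> N i y.
    move=> xy; apply: contrapT => /(not_adherent_nbhd PE) nN; apply: nr.
    by exists y.
  have /(cts_nbhd (x := 0) (addr_cts PE x)) : is_nbhd E (N i) (0 + x).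
    by rewrite add0r; exists m.
  apply: nbhd_sub => y Ny; rewrite -(addrK x y).
  apply: (adherent_subG PE) Ny (cN x (pu_refl PE _ _)).
  move=> _ _ [q [hq <-]] [q' [hq' <-]]; exists (q - q'); split;
    last by rewrite raddfB.
  by apply: hP; rewrite hq hq'.
- by move=> i x; exact: (not_adherent_nbhd PE).
Qed.

End ImageIndex.

(** * Constructions of Polish groups *)

Section PolishConstructions.
Variables (G : zmodType) (E : nat -> G -> G -> Prop).
Hypothesis PE : polish_uniformity E.

(** A point is determined by the sequence of the pieces of mesh E k, for all
    k, in which it lies. *)
Lemma polish_card_continuum :
  exists code : G -> nat -> bool, injective code.
Proof.
have /choice[h hE] := pu_split PE.
exists (fun x n => if unpickle n is Some (k, m) then h k x == m else false).
move=> x y xy; apply: (pu_separated PE) => k; apply: hE.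
have := congr1 (@^~ (pickle (k, h k y))) xy.
by rewrite /= pickleK eqxx => /eqP.
Qed.

Definition near_row n k (u v : 'rV[G]_n) : Prop :=
  forall j, E k (u 0 j) (v 0 j).

Lemma cts_row (H : zmodType) (F : nat -> H -> H -> Prop) n (f : H -> 'rV[G]_n) :
  polish_uniformity F -> (forall j, cts F E (fun x => f x 0 j)) ->
  cts F (@near_row n) f.
Proof.
move=> PF fc x k.
have [i iP] : exists i, forall j, j \in enum 'I_n ->
    forall y, F i x y -> E k (f x 0 j) (f y 0 j).
  apply: common_radius => [j i i' ii' iP y /(near_le PF ii')/iP//|j _].
  exact: fc.
by exists i => y xy j; apply: iP; rewrite ?mem_enum.
Qed.

Lemma polish_row n : polish_uniformity (@near_row n).
Proof.
split.
- by move=> k u j; exact: (pu_refl PE).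
- by move=> k u v uv j; apply: (pu_sym PE).
- by move=> k u v w uv vw j; apply: (pu_half PE (uv j)).
- by move=> u v uv; apply/rowP => j; apply: (pu_separated PE) => k; exact: uv.
- move=> u uP; have /choice[l lP] : forall j, exists l, forall k,
    E k (u k 0 j) l.
    by move=> j; apply: (pu_complete PE) => k; exact: uP.
  by exists (\row_j l j) => k j; rewrite mxE.
- move=> k; apply: countable_split_forall => j.
  by have [h hP] := pu_split PE k;
    exists (fun u : 'rV_n => h (u 0 j)) => u v /hP.
- move=> u v k.
  have [i iP] : exists i, forall j, j \in enum 'I_n -> forall x y,
      E i (u 0 j) x -> E i (v 0 j) y -> E k (u 0 j - v 0 j) (x - y).
    apply: common_radius => [j i i' ii' iP x y xi yi|j _].
      by apply: iP; apply: (near_le PE ii').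
    exact: (pu_sub PE).
  exists i => u' v' uu' vv' j; rewrite !mxE.
  by apply: iP; rewrite ?mem_enum.
Qed.

Variables (H : zmodType) (F : nat -> H -> H -> Prop).
Hypothesis PF : polish_uniformity F.

Definition near_prod k (p q : G * H) : Prop := E k p.1 q.1 /\ F k p.2 q.2.

Lemma polish_pair : polish_uniformity near_prod.
Proof.
split.
- by move=> k p; split; [exact: (pu_refl PE)|exact: (pu_refl PF)].
- by move=> k p q [? ?]; split; [exact: (pu_sym PE)|exact: (pu_sym PF)].
- move=> k p q r [pq1 pq2] [qr1 qr2].
  by split; [exact: (pu_half PE pq1)|exact: (pu_half PF pq2)].
- move=> [p1 p2] [q1 q2] pq; congr pair.
    by apply: (pu_separated PE) => k; have [] := pq k.
  by apply: (pu_separated PF) => k; have [] := pq k.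
- move=> u uP.
  have [l lP] := pu_complete PE (fun k => (uP k).1).
  have [m mP] := pu_complete PF (fun k => (uP k).2).
  by exists (l, m).
- move=> k; have [h hP] := pu_split PE k; have [g gP] := pu_split PF k.
  by apply: (countable_split_by (h := fun p => (h p.1, g p.2))) =>
    p q [/hP + /gP].
- move=> p q k; have [i iP] := pu_sub PE p.1 q.1 k.
  have [j jP] := pu_sub PF p.2 q.2 k.
  exists (maxn i j) => p' q' [p1 p2] [q1 q2]; split.
    by apply: iP; apply: (near_le PE (leq_maxl i j)).
  by apply: jP; apply: (near_le PF (leq_maxr i j)).
Qed.

Variable L : {additive G -> H}.

Definition in_kernel : pred G := fun x => L x == 0.

Fact in_kernel_zmod_closed : zmod_closed in_kernel.
Proof.
split=> [|x y]; rewrite !unfold_in /in_kernel ?raddf0 // raddfB.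
by move=> /eqP-> /eqP->; rewrite subrr.
Qed.

HB.instance Definition _ := GRing.isZmodClosed.Build G in_kernel
  in_kernel_zmod_closed.

Record additive_kernel :=
  AdditiveKernel { kernel_val : G; _ : kernel_val \in in_kernel }.

HB.instance Definition _ := [isSub for kernel_val].
HB.instance Definition _ := [Choice of additive_kernel by <:].
HB.instance Definition _ := [SubChoice_isSubZmodule of additive_kernel by <:].

Definition near_kernel k (x y : additive_kernel) : Prop := E k (val x) (val y).

Lemma kernelP (x : additive_kernel) : L (val x) = 0.
Proof. by apply/eqP; exact: (valP x). Qed.

Lemma polish_kernel : cts E F L -> polish_uniformity near_kernel.
Proof.
move=> Lc; split.
- by move=> k x; exact: (pu_refl PE).
- by move=> k x y; exact: (pu_sym PE).
- by move=> k x y z; exact: (pu_half PE).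
- by move=> x y xy; apply: val_inj; exact: (pu_separated PE).
- move=> u /(pu_complete PE)[l lP].
  suff Ll : l \in in_kernel by exists (AdditiveKernel Ll).
  rewrite unfold_in /in_kernel; apply/eqP/(pu_separated PF) => k.
  have [j jP] := Lc l k; rewrite -(kernelP (u j)).
  exact/jP/(pu_sym PE).
- by move=> k; have [h hP] := pu_split PE k; exists (h \o val) => x y /hP.
- move=> x y k; have [j jP] := pu_sub PE (val x) (val y) k.
  by exists j => x' y'; exact: jP.
Qed.

End PolishConstructions.

Section MetricUniformity.
Import numFieldNormedType.Exports.
Local Open Scope classical_set_scope.
Variables (K : realType) (A : topologicalZmodType).
Hypothesis A_sep : separable_space A.

(** The uniformity is E k x y := d x y < 2^-k; the comparison of
    neighbourhoods is what transports continuity of the operations. *)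
Lemma polish_uniformity_of_metric : completely_metrizable K A ->
  exists E : nat -> A -> A -> Prop, polish_uniformity E /\
    forall x (U : set A), nbhs x U <-> is_nbhd E U x.
Proof.
move=> [d [d0 dC dD dO dcpl]].
pose h : K := 2^-1.
have h0 : 0 < h by rewrite invr_gt0 ltr0n.
have hS k : h ^+ k.+1 + h ^+ k.+1 = h ^+ k.
  by rewrite exprS -mulrDl (_ : h + h = 1) ?mul1r // [RHS]splitr div1r.
have hpos k : 0 < h ^+ k by exact: exprn_gt0.
have hsmall e : 0 < e -> exists k, h ^+ k < e.
  move=> e0; exists (Num.bound e^-1); rewrite exprVn -[ltRHS]invrK.
  rewrite ltf_pV2 ?posrE ?invr_gt0 ?exprn_gt0 ?ltr0n //.
  apply: lt_trans (archi_boundP _) _; first by rewrite invr_ge0 ltW.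
  by rewrite -natrX ltr_nat ltn_expl.
have dxx x : d x x = 0 by apply/d0.
have d_ge0 x y : 0 <= d x y.
  by have := dD x y x; rewrite dxx (dC y x) -mulr2n pmulrn_lge0.
pose E k x y := d x y < h ^+ k.
have Esym k x y : E k x y -> E k y x by rewrite /E dC.
have Ehalf k x y z : E k.+1 x y -> E k.+1 y z -> E k x z.
  rewrite /E => xy yz; apply: le_lt_trans (dD x y z) _.
  by rewrite -hS; exact: ltrD.
have ball_open x k : open [set y | E k x y].
  apply/dO => y xy; exists (h ^+ k - d x y); first by rewrite subr_gt0.
  move=> z /=; rewrite ltrBrDl; exact: le_lt_trans.
have nbhsE' x (U : set A) : nbhs x U <-> is_nbhd E U x.
  split=> [|[k kU]].
    rewrite nbhsE => -[B [/dO Bo Bx] BU]; have [e e0 eB] := Bo x Bx.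
    have [k ke] := hsmall e e0; exists k => y xy; apply/BU/eB/(lt_trans xy ke).
  rewrite nbhsE; exists [set y | E k x y]; last exact: kU.
  by split=> //=; rewrite /E dxx.
have Enbhs k x : nbhs x [set y | E k x y] by apply/nbhsE'; exists k.
exists E; split=> //; split=> //.
- by move=> k x; rewrite /E dxx.
- move=> x y xy; apply/d0/eqP; rewrite eq_le d_ge0 andbT leNgt; apply/negP.
  by move=> /hsmall[k]; rewrite ltNge ltW //; exact: xy.
- move=> u uE.
  have chain m : forall k, E k.+1 (u k) (u (k + m)%N).
    elim: m => [|m IH] k; first by rewrite addn0 /E dxx.
    by apply: Ehalf (uE k) _; rewrite -addSnnS.
  have chain' k i : (k <= i)%N -> E k.+1 (u k) (u i).
    by move=> /subnKC <-; exact: chain.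
  have [e e0|l ul] := dcpl u.
    have [k ke] := hsmall e e0; exists k => i j ki kj; apply: lt_trans ke.
    apply: (Ehalf _ _ (u k)); last exact: chain'.
    by apply: Esym; exact: chain'.
  exists l => k; have [N _ NP] := ul _ (Enbhs k.+1 l).
  by apply: Ehalf (chain (N - k)%N k) _; apply/Esym/NP; rewrite /= -leq_subLR.
- move=> k; have [D /countable_injP[g gD] D_dense] := A_sep.
  have /choice[r rP] : forall x, exists y, D y /\ E k.+1 x y.
    move=> x; have [|y [xy Dy]] := D_dense _ _ (ball_open x k.+1).
      by exists x; rewrite /= /E dxx.
    by exists y.
  exists (g \o r) => x y /= /gD gxy; have [Dx xr] := rP x; have [Dy yr] := rP y.
  by apply: (Ehalf _ _ (r x)) => //; apply: Esym; rewrite gxy ?inE.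
- move=> x y k.
  have [[P Q] /= [/nbhsE'[i iP] /nbhsE'[j jQ]] PQ] :=
    @sub_continuous A (x, y) _ (Enbhs k (x - y)).
  exists (maxn i j) => x' y' xx' yy'; apply: (PQ (x', y')); split=> /=.
    apply: iP; apply: lt_le_trans xx' _.
    by rewrite ler_wiXn2l ?leq_maxl ?ltW // invf_lt1 ?ltr1n.
  apply: jQ; apply: lt_le_trans yy' _.
  by rewrite ler_wiXn2l ?leq_maxr ?ltW // invf_lt1 ?ltr1n.
Qed.

End MetricUniformity.

(** * The index of a pp-pair *)

Section PPIndex.
Variables (R : nzRingType) (M : lmodType R) (E : nat -> M -> M -> Prop).
Hypotheses (PE : polish_uniformity E)
  (scale_cts : forall r : R, cts E E (fun x => r *: x)).

Lemma cts_add (H : zmodType) (F : nat -> H -> H -> Prop) (f g : H -> M) :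
  polish_uniformity F -> cts F E f -> cts F E g -> cts F E (fun x => f x + g x).
Proof.
move=> PF fc gc x k.
have [j jP] := pu_sub PE (f x) (- g x) k.
have [j1 j1P] := fc x j.
have [j2 j2P] := subl_cts PE 0 (g x) j; have [j3 j3P] := gc x j2.
exists (maxn j1 j3) => y xy; rewrite -[g x]opprK -[g y]opprK; apply: jP.
  exact/j1P/(near_le PF (leq_maxl _ _) xy).
rewrite -[- g x]sub0r -[- g y]sub0r.
exact/j2P/j3P/(near_le PF (leq_maxr _ _) xy).
Qed.

Lemma cts_lincomb (H : zmodType) (F : nat -> H -> H -> Prop) m (a : 'I_m -> R)
    (f : 'I_m -> H -> M) :
  polish_uniformity F -> (forall j, cts F E (f j)) ->
  cts F E (fun x => \sum_j a j *: f j x).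
Proof.
move=> PF fc; elim: m a f fc => [|m IH] a f fc.
  by move=> x k; exists 0%N => y _; rewrite !big_ord0; exact: (pu_refl PE).
have E1 : (fun x => \sum_j a j *: f j x) =
    (fun x => \sum_(j < m) a (widen_ord (leqnSn m) j) *:
         f (widen_ord (leqnSn m) j) x + a ord_max *: f ord_max x).
  by apply/funext => x; rewrite big_ord_recr.
rewrite E1; apply: cts_add => //; first exact: IH.
move=> x k; have [j jP] := scale_cts (a ord_max) (f ord_max x) k.
by have [i iP] := fc ord_max x j; exists i => y /iP/jP.
Qed.

Variables (n : nat) (phi psi : ppform R n).

Lemma pp_lin_cts (chi : ppform R n) :
  cts (near_prod (near_row E (n := n)) (near_row E (n := pp_ex chi)))
      (near_row E (n := pp_eqs chi)) (pp_lin chi).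
Proof.
have PP := polish_pair (polish_row PE n) (polish_row PE (pp_ex chi)).
apply: (cts_row PP) => i.
have -> : (fun p => pp_lin chi p 0 i) =
    (fun p : 'rV[M]_n * 'rV[M]_(pp_ex chi) =>
       \sum_j pp_free chi i j *: p.1 0 j +
       \sum_j pp_bound chi i j *: p.2 0 j).
  by apply/funext => p; rewrite mxE.
by apply: (cts_add PP); apply: (cts_lincomb _ PP) => j p k; exists k => q [].
Qed.

Let solution := additive_kernel (pp_lin (M := M) phi).
Let near_solution : nat -> solution -> solution -> Prop :=
  near_kernel (near_prod (near_row E (n := n)) (near_row E (n := pp_ex phi)))
    (L := pp_lin phi).

(** The kernel of this map on solutions (u, w) of phi and tuples w' is the
    group of triples (u, w, w') in which w' witnesses psi(u). *)
Definition psi_lin (p : solution * 'rV[M]_(pp_ex psi)) : 'rV[M]_(pp_eqs psi) :=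
  pp_lin psi ((val p.1).1, p.2).

Fact psi_lin_is_zmod_morphism : zmod_morphism psi_lin.
Proof. by move=> p q; rewrite /psi_lin -pp_linB. Qed.

HB.instance Definition _ :=
  GRing.isZmodMorphism.Build _ _ psi_lin psi_lin_is_zmod_morphism.

Lemma pp_index_dichotomy :
  countable (pp_cosets phi psi M) \/
  (pp_cosets phi psi M #= [set: nat -> bool]%classic)%card.
Proof.
have PP := polish_pair (polish_row PE n) (polish_row PE (pp_ex phi)).
have PS : polish_uniformity near_solution :=
  polish_kernel PP (polish_row PE _) (@pp_lin_cts phi).
have PQ := polish_pair PS (polish_row PE (pp_ex psi)).
have psi_c : cts (near_prod near_solution (near_row E (n := pp_ex psi)))
    (near_row E (n := pp_eqs psi)) psi_lin.
  move=> p k.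
  have [j jP] := @pp_lin_cts psi ((val p.1).1, p.2) k.
  exists j => q [[pq1 _] pq2]; exact: jP (_, _) (conj pq1 pq2).
have PK := polish_kernel PQ (polish_row PE _) psi_c.
pose f : {additive additive_kernel psi_lin -> solution} := fst \o val.
have f_cts : cts
    (near_kernel (near_prod near_solution (near_row E (n := pp_ex psi)))
       (L := psi_lin)) near_solution f.
  by move=> x k; exists k => y [].
have solP (x : solution) : pp_sol phi M (val x).1.
  by apply/pp_solP; exists (val x).2; rewrite -surjective_pairing kernelP.
have kerP (x y : solution) :
    (exists q, x - y = f q) <-> pp_sol psi M ((val x).1 - (val y).1).
  split=> [[q xyq]|/pp_solP[w wP]].
    apply/pp_solP; exists (val q).2.
    have := kernelP q; rewrite /= /psi_lin.
    by have -> : (val q).1 = x - y by rewrite xyq.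
  have wK : (x - y, w) \in in_kernel psi_lin.
    by rewrite unfold_in /in_kernel /= /psi_lin wP.
  by exists (AdditiveKernel wK).
have [[h hP]|[c cP]] := image_index_dichotomy PS PK f_cts.
  left; apply/countable_cosetsP.
  have /choice[g gP] : forall u, exists x : solution, pp_sol phi M u ->
    (val x).1 = u.
    move=> u; have [/pp_solP[w uw]|nu] := pselect (pp_sol phi M u);
      last by exists 0.
    have uK : (u, w) \in in_kernel (pp_lin phi).
      by rewrite unfold_in /in_kernel /= uw.
    by exists (AdditiveKernel uK).
  by exists (h \o g) => u v /gP {2}<- /gP {2}<- /hP/kerP.
right; apply: Cantor_Bernstein.
  have [code codeI] := polish_card_continuum (polish_row PE n).
  have /choice[g gP] : forall C, exists u, pp_cosets phi psi M C ->
    C = pp_coset psi u.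
    move=> C; have [[u uP ->]|nC] := pselect (pp_cosets phi psi M C);
      first by exists u.
    by exists 0.
  apply/pcard_injP; exists (code \o g) => C D;
    rewrite !inE => /gP{2}-> /gP{2}->.
  by move=> /codeI ->.
apply/pcard_leP/injfunPex; exists (fun a => pp_coset psi (val (c a)).1).
  by move=> a _; exists (val (c a)).1.
move=> a b _ _ /pp_coset_eq/kerP ab; apply: contrapT => /cP; exact.
Qed.

End PPIndex.

Lemma nat_bool_uncountable : ~ countable [set: nat -> bool]%classic.
Proof.
move=> /countable_injP[f finj].
(* Cantor's diagonal, the injection playing the role of an enumeration. *)
pose b n := `[< exists a, f a = n /\ ~~ a n >].
have [bfb|nbfb] := boolP (b (f b)); last first.
  by case/negP: (nbfb); apply/asboolP; exists b.
have /asboolP[a [fab]] := bfb.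
by rewrite (finj a b) ?inE // bfb.
Qed.

Lemma polish_lmod_uniformity (K : realType) (R : nzRingType)
    (A : polishModType K R) :
  exists E : nat -> polish_lmod A -> polish_lmod A -> Prop,
    polish_uniformity E /\ forall r : R, cts E E (fun x => r *: x).
Proof.
have [E [PE nbhsP]] := polish_uniformity_of_metric (polish_separable A)
  (polish_completely_metrizable A).
exists E; split=> [|r x k]; first by split; case: PE.
have rc : {for x : A, continuous (fun y : A => polish_scale r y)}%classic.
  apply: (@continuous_comp _ _ _ (fun y : A => (r : discrete_topology R, y))
    (fun z : discrete_topology R * A => polish_scale z.1 z.2)).
    move=> U [[V W] /= [rV xW] VW]; apply: filterS xW => y yW.
    by apply: (VW (_, _)); split=> //; exact: nbhs_singleton rV.
  exact: polish_scale_continuous.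
have Ek : nbhs (polish_scale r x : A) (E k (polish_scale r x)).
  by apply: (nbhsP (polish_scale r x) (E k (polish_scale r x))).2; exists k.
by have [j jP] := (nbhsP x _).1 (rc _ Ek); exists j.
Qed.

End PolishGroups.

Theorem corollary3p15 (K : realType) (R : nzRingType)
    (R_countable : countable [set: R]%classic)
    (A : polishModType K R) (n : nat) (phi psi : ppform R n)
    (phi_psi : pp_pair phi psi) :
  (countable (pp_cosets phi psi (polish_lmod A)) \/
   (pp_cosets phi psi (polish_lmod A) #= [set: nat -> bool]%classic)%card) /\
  (provable (Th_Pun (polish_lmod A)) (index_gt1 phi psi) <->
   (pp_cosets phi psi (polish_lmod A) #= [set: nat -> bool]%classic)%card).
Proof.
have [E [PE scale_cts]] := polish_lmod_uniformity A.
have dich := pp_index_dichotomy PE scale_cts phi psi.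
split=> //; split=> [prov|/eq_countable ctbl]; last first.
  apply/P_ax/Pun_infinite => //; rewrite ctbl; exact: nat_bool_uncountable.
case: dich => // ctbl; case: (@Th_Pun_consistent R (polish_lmod A)).
by apply: P_mp prov; apply/P_ax/Pun_one.
Qed.
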